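(* The following hold: (i) $\varphi(x)=\varphi_\gamma(x)$ for all $\gamma\in(0,\gamma_g)$ and all $x\in\operatorname{fix}T_\gamma$; (ii) $\inf\varphi=\inf\varphi_\gamma$ and $\operatorname{argmin}\varphi=\operatorname{argmin}\varphi_\gamma$ for all $\gamma\in(0,\min\{1/L_f,\gamma_g\})$.
   Context: Standing assumptions: $f:\mathbb{R}^n\to\mathbb{R}$ is differentiable with Lipschitz continuous gradient, $L_f$ denoting the Lipschitz modulus of $\nabla f$ (with $1/L_f=+\infty$ if $L_f=0$); $g:\mathbb{R}^n\to\mathbb{R}\cup\{+\infty\}$ is proper, lower semicontinuous and prox-bounded, meaning that $g+\frac{1}{2\gamma}\|\cdot\|^2$ is bounded below for some $\gamma>0$; $\gamma_g\in(0,+\infty]$ is the supremum of all such $\gamma$; $\varphi:=f+g$ and $\operatorname{argmin}\varphi\neq\emptyset$. Neither function need be convex. For $\gamma>0$, the forward-backward envelope is $\varphi_\gamma(x):=\inf_{z\in\mathbb{R}^n}\{f(x)+\langle\nabla f(x),z-x\rangle+\frac{1}{2\gamma}\|z-x\|^2+g(z)\}$, and $T_\gamma(x)$ is the set of minimizers $z$ in this problem, equivalently $T_\gamma(x)=\operatorname{prox}_{\gamma g}(x-\gamma\nabla f(x))$ with $\operatorname{prox}_{\gamma g}(y):=\operatorname{argmin}_z\{g(z)+\frac{1}{2\gamma}\|z-y\|^2\}$; $\operatorname{fix}T_\gamma:=\{x:x\in T_\gamma(x)\}$. *)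

(* Defs.v *)
From HB Require Import structures.
From mathcomp Require Import all_boot all_order all_algebra.
From mathcomp Require Import all_classical all_reals all_analysis.

Set Implicit Arguments.
Unset Strict Implicit.
Unset Printing Implicit Defensive.

Import Order.TTheory GRing.Theory Num.Theory.
Import numFieldNormedType.Exports.

Local Open Scope classical_set_scope.
Local Open Scope ring_scope.

(* The library norm on ['rV[R]_n] is the sup norm; it induces the usual
   topology, but everything metric below uses the Euclidean structure. *)
Definition dotr (R : realType) (n : nat) (x y : 'rV[R]_n) : R :=
  \sum_(i < n) x ord0 i * y ord0 i.

Definition enorm (R : realType) (n : nat) (x : 'rV[R]_n) : R :=
  Num.sqrt (dotr x x).

(* Row of partial derivatives: the gradient when [f] is differentiable. *)
Definition grad (R : realType) (n : nat) (f : 'rV[R]_n -> R)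
    (x : 'rV[R]_n) : 'rV[R]_n :=
  \row_(i < n) 'D_(delta_mx ord0 i) f x.

Definition lipschitz_const (R : realType) (n : nat)
    (F : 'rV[R]_n -> 'rV[R]_n) : set R :=
  [set L | 0 <= L /\ forall x y, enorm (F x - F y) <= L * enorm (x - y)].

(* Smallest Lipschitz constant. Its inverse is to be taken in [\bar R], where
   0^-1 = +oo. *)
Definition lipschitz_modulus (R : realType) (n : nat)
    (F : 'rV[R]_n -> 'rV[R]_n) : R :=
  inf (lipschitz_const F).

Definition proper_fun (R : realType) (n : nat) (g : 'rV[R]_n -> \bar R) : Prop :=
  (forall x, g x != -oo%E) /\ (exists x, g x != +oo%E).

Definition prox_params (R : realType) (n : nat) (g : 'rV[R]_n -> \bar R) :
    set R :=
  [set gamma | 0 < gamma /\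
    exists m : R, forall z,
      (m%:E <= g z + ((2 * gamma)^-1 * enorm z ^+ 2)%:E)%E].

Definition prox_bounded (R : realType) (n : nat) (g : 'rV[R]_n -> \bar R) :
    Prop :=
  prox_params g !=set0.

Definition prox_threshold (R : realType) (n : nat) (g : 'rV[R]_n -> \bar R) :
    \bar R :=
  ereal_sup (EFin @` prox_params g).

(* If [F] is constantly +oo this is the full set and not the empty one; this
   does not arise for functions that are finite somewhere. *)
Definition argmin (R : realType) (T : Type) (F : T -> \bar R) : set T :=
  [set x | forall y, (F x <= F y)%E].

Definition objective (R : realType) (n : nat) (f : 'rV[R]_n -> R)
    (g : 'rV[R]_n -> \bar R) (x : 'rV[R]_n) : \bar R :=
  ((f x)%:E + g x)%E.

Definition fb_model (R : realType) (n : nat) (f : 'rV[R]_n -> R)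
    (g : 'rV[R]_n -> \bar R) (gamma : R) (x z : 'rV[R]_n) : \bar R :=
  ((f x + dotr (grad f x) (z - x)
      + (2 * gamma)^-1 * enorm (z - x) ^+ 2)%:E + g z)%E.

Definition fb_envelope (R : realType) (n : nat) (f : 'rV[R]_n -> R)
    (g : 'rV[R]_n -> \bar R) (gamma : R) (x : 'rV[R]_n) : \bar R :=
  ereal_inf (range (fb_model f g gamma x)).

Definition fb_operator (R : realType) (n : nat) (f : 'rV[R]_n -> R)
    (g : 'rV[R]_n -> \bar R) (gamma : R) (x : 'rV[R]_n) : set 'rV[R]_n :=
  argmin (fb_model f g gamma x).

Definition fixpoints (T : Type) (F : T -> set T) : set T := [set x | F x x].

(* Main.v *)
(** If [L < 1/gamma] is a Lipschitz constant of the gradient, the descent lemma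
    gives [fb_model x z >= phi z + c |z - x|^2] with [c = (1/gamma - L)/2 > 0].
    Hence [inf phi <= phi_gamma <= phi], and the infima agree.  If [x] minimizes
    [phi_gamma] but [phi x > inf phi], then [fb_model x z] stays bounded away
    from [inf phi]: near [x] by lower semicontinuity of [phi], far from [x] by
    the quadratic term. *)
Require Import Defs.
From HB Require Import structures.
From mathcomp Require Import all_boot all_order all_algebra.
From mathcomp Require Import all_classical all_reals all_analysis.
From mathcomp Require Import ring lra.

Import Order.TTheory GRing.Theory Num.Theory.
Import numFieldNormedType.Exports.

Local Open Scope classical_set_scope.
Local Open Scope ring_scope.

Section euclidean.
Context {R : realType} {n : nat}.
Implicit Types x y z d : 'rV[R]_n.

Lemma dotrC x y : dotr x y = dotr y x.
Proof. by apply: eq_bigr => i _; rewrite mulrC. Qed.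

Lemma dotrBl x y z : dotr (x - y) z = dotr x z - dotr y z.
Proof. by rewrite /dotr -sumrB; apply: eq_bigr => i _; rewrite !mxE mulrBl. Qed.

Lemma dotrZl (a : R) x z : dotr (a *: x) z = a * dotr x z.
Proof. by rewrite /dotr mulr_sumr; apply: eq_bigr => i _; rewrite !mxE mulrA. Qed.

Lemma dotr0 x : dotr x 0 = 0.
Proof. by rewrite /dotr big1// => i _; rewrite mxE mulr0. Qed.

Lemma dotr_ge0 x : 0 <= dotr x x.
Proof. by apply: sumr_ge0 => i _; rewrite -expr2 sqr_ge0. Qed.

Lemma enorm_ge0 x : 0 <= enorm x.
Proof. exact: sqrtr_ge0. Qed.

Lemma sqr_enorm x : enorm x ^+ 2 = dotr x x.
Proof. by rewrite sqr_sqrtr// dotr_ge0. Qed.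

Lemma enormZ (a : R) x : enorm (a *: x) = `|a| * enorm x.
Proof.
by rewrite /enorm dotrZl dotrC dotrZl mulrA -expr2 sqrtrM ?sqr_ge0// sqrtr_sqr.
Qed.

Lemma ler_coord_enorm x i : `|x ord0 i| <= enorm x.
Proof.
rewrite -sqrtr_sqr ler_wsqrtr// /dotr (bigD1 i)//= -expr2 lerDl.
by apply: sumr_ge0 => j _; rewrite -expr2 sqr_ge0.
Qed.

Lemma ler_norm_enorm x : `|x| <= enorm x.
Proof.
rewrite [leLHS]/Num.Def.normr/= mx_normrE.
apply: bigmax_le => [|[i j] _]; first exact: enorm_ge0.
by rewrite /= ord1 ler_coord_enorm.
Qed.

Lemma dotr_eq0 x y : enorm y = 0 -> dotr x y = 0.
Proof.
move=> y0; apply: big1 => i _.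
suff -> : y ord0 i = 0 by rewrite mulr0.
by apply/eqP; rewrite -normr_eq0 eq_le normr_ge0 andbT -y0 ler_coord_enorm.
Qed.

(** Cauchy-Schwarz, by expanding the square of [enorm y *: x - enorm x *: y]. The expansion has the
    factor [2 * (a * b)], so vanishing norms are treated first. *)
Lemma ler_dotr_enorm x y : dotr x y <= enorm x * enorm y.
Proof.
have [y0|y0] := eqVneq (enorm y) 0; first by rewrite dotr_eq0// y0 mulr0.
have y_gt0 : 0 < enorm y by rewrite lt_neqAle eq_sym y0 enorm_ge0.
have [x0|x0] := eqVneq (enorm x) 0; first by rewrite dotrC dotr_eq0// x0 mul0r.
have x_gt0 : 0 < enorm x by rewrite lt_neqAle eq_sym x0 enorm_ge0.
have := dotr_ge0 (enorm y *: x - enorm x *: y).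
rewrite !(dotrBl, dotrZl) ![dotr _ (_ - _)]dotrC !(dotrBl, dotrZl).
rewrite -!sqr_enorm (dotrC y x).
set a := enorm x; set b := enorm y; set c := dotr x y.
have -> : b * (b * a ^+ 2 - a * c) - a * (b * c - a * b ^+ 2) =
  2 * (a * b) * (a * b - c) by ring.
by rewrite pmulr_rge0 ?subr_ge0// mulr_gt0// mulr_gt0.
Qed.

(** Neighbourhoods come from the sup norm, which the Euclidean norm dominates, so the Euclidean ball
    of the same radius fits inside. *)
Lemma nbhs_enorm x (V : set 'rV[R]_n) : nbhs x V ->
  exists2 e : R, 0 < e & forall z, enorm (z - x) < e -> V z.
Proof.
move=> /nbhs_ballP[e /= e0 xV]; exists e => // z zx; apply: xV.
rewrite -ball_normE /= distrC; exact: le_lt_trans (ler_norm_enorm _) zx.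
Qed.

End euclidean.

Section descent.
Context {R : realType} {n : nat}.
Variable f : 'rV[R]_n -> R.
Hypothesis f_diff : forall x, differentiable f x.

(** Differentiability makes the derivative linear in the direction, so the partial derivatives
    stored in [grad] determine it. *)
Lemma derive_grad x d : 'D_d f x = dotr (grad f x) d.
Proof.
rewrite deriveE// {1}(row_sum_delta d) linear_sum/=.
by apply: eq_bigr => i _; rewrite linearZ/= mxE deriveE// mulrC.
Qed.

Lemma is_derive_segment x d (t : R) :
  is_derive t (1 : R) (fun s : R => f (x + s *: d)) (dotr (grad f (x + t *: d)) d).
Proof.
rewrite -derive_grad.
(* The difference quotient along the segment is that of [f] at [x + t *: d] in direction [d], so no
   chain rule is involved. *)
have quotE : (fun h : R => h^-1 *: (((fun s : R => f (x + s *: d)) \o shift t)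
      (h *: (1 : R)) - f (x + t *: d))) =
    (fun h : R => h^-1 *: ((f \o shift (x + t *: d)) (h *: d) - f (x + t *: d))).
  apply/funext => h /=; congr (_ *: (f _ - _)).
  by rewrite (_ : h *: 1 = h) ?scalerDl 1?addrCA// /GRing.scale/= mulr1.
have fd : derivable f (x + t *: d) d by exact: diff_derivable.
apply: DeriveDef; first by rewrite /derivable quotE.
by rewrite /derive quotE.
Qed.

Lemma descent_lemma (L : R) x z : lipschitz_const (grad f) L ->
  f z <= f x + dotr (grad f x) (z - x) + L / 2 * enorm (z - x) ^+ 2.
Proof.
move=> [L0 gradL]; set d := z - x.
(* Subtracting the linear and quadratic terms turns the claim into [h 1 <= h 0], which the mean
   value theorem reduces to [dh c <= 0]. *)
pose h (s : R) := f (x + s *: d) - s * dotr (grad f x) d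
  - s ^+ 2 * (L / 2 * enorm d ^+ 2).
pose dh (s : R) := dotr (grad f (x + s *: d)) d - dotr (grad f x) d
  - s * (L * enorm d ^+ 2).
have hdh (s : R) : is_derive s (1 : R) h (dh s).
  have fs := is_derive_segment x d s.
  apply: is_derive_eq.
  by rewrite /dh /GRing.scale/=; field.
have h_cont : {within `[0, 1], continuous h}.
  by apply: derivable_within_continuous => s _; case: (hdh s).
have [c c01 h10] := MVT_segment ler01 (fun s _ => hdh s) h_cont.
have dh0 : dh c <= 0.
  rewrite /dh -dotrBl subr_le0 (le_trans (ler_dotr_enorm _ _))//.
  have c0 : 0 <= c by move: c01; rewrite in_itv/= => /andP[].
  have := gradL (x + c *: d) x; rewrite (addrC x) addrK enormZ ger0_norm// => gradc.
  apply: (le_trans (ler_wpM2r (enorm_ge0 _) gradc)).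
  by rewrite le_eqVlt; apply/orP; left; apply/eqP; ring.
move: h10; rewrite /h subr0 mulr1 !scale1r !scale0r addr0 subrKC.
rewrite expr0n expr1n/= !mul1r !mul0r !subr0.
lra.
Qed.

End descent.

Section forward_backward.
Context {R : realType} {n : nat}.
Variables (f : 'rV[R]_n -> R) (g : 'rV[R]_n -> \bar R).

Lemma fb_model_diag (gamma : R) x : fb_model f g gamma x x = objective f g x.
Proof.
rewrite /fb_model /objective subrr dotr0 sqr_enorm dotr0.
by rewrite mulr0 !addr0.
Qed.

Lemma fb_envelope_le (gamma : R) x :
  (fb_envelope f g gamma x <= objective f g x)%E.
Proof.
by rewrite -(fb_model_diag gamma); apply: ereal_inf_lbound; exists x.
Qed.

(** At a fixed point the infimum of the model is attained at [z = x], where the model equals the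
    objective. *)
Lemma fb_envelope_fixpoints (gamma : R) x :
  fixpoints (fb_operator f g gamma) x -> objective f g x = fb_envelope f g gamma x.
Proof.
move=> xfix; apply/eqP; rewrite eq_le fb_envelope_le andbT.
apply: le_ereal_inf_tmp => _ [z _ <-]; rewrite -(fb_model_diag gamma); exact: xfix.
Qed.

Hypothesis f_diff : forall x, differentiable f x.

(** The extra term is the gap between the coefficient [1 / (2 * gamma)] of the model and [L / 2] of
    the descent lemma. *)
Lemma objective_le_fb_model (L gamma : R) x z :
  lipschitz_const (grad f) L ->
  (objective f g z + ((gamma^-1 - L) / 2 * enorm (z - x) ^+ 2)%:E
    <= fb_model f g gamma x z)%E.
Proof.
move=> gradL; rewrite /objective /fb_model addeAC -EFinD leeD2r// lee_fin.
have := descent_lemma f f_diff L x z gradL; rewrite invfM; lra.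
Qed.

Lemma argmin_objective_fin : proper_fun g -> forall x, argmin (objective f g) x ->
  exists m : R, objective f g x = m%:E.
Proof.
move=> [gNy [y gy]] x /(_ y); rewrite /objective.
case: (g y) (gNy y) gy => [r| |]//= _ _; case: (g x) (gNy x) => [s| |]//= _ _.
by exists (f x + s).
Qed.

(** By contraposition: if [m] lies below the objective at [x], the model exceeds [m] by a margin
    uniform in [z]. Bounding the infimum this way avoids choosing a minimizer of the model. *)
Lemma objective_le_of_fb_envelope (c gamma m : R) x : lower_semicontinuous g ->
  0 < c ->
  (forall z, (objective f g z + (c * enorm (z - x) ^+ 2)%:E
    <= fb_model f g gamma x z)%E) ->
  (forall z, (m%:E <= objective f g z)%E) ->
  (fb_envelope f g gamma x <= m%:E)%E -> (objective f g x <= m%:E)%E.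
Proof.
move=> g_lsc c0 modelge mle envle; rewrite leNgt; apply/negP => mx.
(* A real level below [g x] lets the finite and infinite cases be treated alike. *)
have [a ma ag] : exists2 a, m - f x < a & (a%:E < g x)%E.
  move: mx; rewrite /objective; case: (g x) => [r| |]//=.
  - rewrite -EFinD lte_fin -ltrBlDl => mr.
    by exists ((m - f x + r) / 2); rewrite ?lte_fin; lra.
  - by move=> _; exists (m - f x + 1); rewrite ?ltry//; lra.
(* Half the gap: [f z > f x - e] and [g z > a] add up to more than [m + e]. *)
pose e := (a - (m - f x)) / 2.
have e0 : 0 < e by rewrite /e; lra.
have [V xV gV] := g_lsc _ _ ag.
have fV : nbhs x [set z | f x - e < f z].
  by apply: (cvgr_gt _ (differentiable_continuous (f_diff x))); lra.
have [d d0 dV] := nbhs_enorm x _ (filterI xV fV).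
(* The margin is [e] within distance [d] of [x] and [c * d ^+ 2] beyond it. *)
pose b := Num.min e (c * d ^+ 2).
have b0 : 0 < b by rewrite lt_min e0 mulr_gt0// exprn_gt0.
have /le_trans/(_ envle) : ((m + b)%:E <= fb_envelope f g gamma x)%E.
  apply: le_ereal_inf_tmp => _ [z _ <-]; apply: le_trans (modelge z).
  have cz : 0 <= c * enorm (z - x) ^+ 2 by rewrite mulr_ge0 ?sqr_ge0// ltW.
  rewrite EFinD; have [zd|dz] := ltP (enorm (z - x)) d.
    have [/gV ag' /= fz] := dV _ zd.
    apply: (@le_trans _ _ (objective f g z)); last by rewrite leeDl// lee_fin.
    rewrite -EFinD (@le_trans _ _ ((f z)%:E + a%:E)%E)//; last first.
      by rewrite leeD2l// ltW.
    have be : b <= e by rewrite ge_min lexx.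
    by rewrite -EFinD lee_fin; move: be fz; rewrite /e; lra.
  apply: leeD => //; rewrite lee_fin ge_min; apply/orP; right.
  by rewrite ler_pM2l// ler_sqr// nnegrE ?enorm_ge0// ltW.
by rewrite lee_fin; lra.
Qed.

End forward_backward.

(** A number strictly above an infimum exceeds some element of the set; hence the modulus need not
    be shown to be a Lipschitz constant itself. *)
Lemma lipschitz_const_lt_inv {R : realType} {n : nat}
    (F : 'rV[R]_n -> 'rV[R]_n) (gamma : R) :
  lipschitz_const F !=set0 -> 0 < gamma ->
  (gamma%:E < (lipschitz_modulus F)%:E^-1)%E ->
  exists2 L, lipschitz_const F L & L < gamma^-1.
Proof.
move=> F0 g0 gF; apply: inf_lt => //.
have L0 : 0 <= lipschitz_modulus F by apply: lb_le_inf => // L [].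
(* Inverting in [\bar R] also covers modulus 0, whose inverse is [+oo]. *)
move: gF; rewrite inve_pgt ?inE ?lee_fin ?(ltW g0)//.
by rewrite inver gt_eqF// lte_fin.
Qed.

Theorem theorem4p4 (R : realType) (n : nat)
  (f : 'rV[R]_n -> R) (g : 'rV[R]_n -> \bar R)
  (f_diff : forall x, differentiable f x)
  (gradf_lip : lipschitz_const (grad f) !=set0)
  (g_proper : proper_fun g)
  (g_lsc : lower_semicontinuous g)
  (g_pb : prox_bounded g)
  (phi_argmin : argmin (objective f g) !=set0) :
  (forall gamma : R, 0 < gamma -> (gamma%:E < prox_threshold g)%E ->
     forall x, fixpoints (fb_operator f g gamma) x ->
       objective f g x = fb_envelope f g gamma x)
  /\
  (forall gamma : R, 0 < gamma ->
     (gamma%:E < Order.min ((lipschitz_modulus (grad f))%:E^-1)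
                           (prox_threshold g))%E ->
     ereal_inf (range (objective f g)) =
       ereal_inf (range (fb_envelope f g gamma)) /\
     argmin (objective f g) = argmin (fb_envelope f g gamma)).
Proof.
split=> [gamma _ _ x|gamma gamma0]; first exact: fb_envelope_fixpoints.
rewrite lt_min => /andP[gammaL _].
have [L gradL Lgamma] := lipschitz_const_lt_inv _ _ gradf_lip gamma0 gammaL.
pose c := (gamma^-1 - L) / 2.
have c0 : 0 < c by rewrite divr_gt0// subr_gt0.
have model_ge x z := objective_le_fb_model f g f_diff L gamma x z gradL.
have [xs xs_min] := phi_argmin.
have [m xsm] := argmin_objective_fin f g g_proper xs xs_min.
have phi_ge z : (m%:E <= objective f g z)%E by rewrite -xsm.
have env_ge x : (m%:E <= fb_envelope f g gamma x)%E.
  apply: le_ereal_inf_tmp => _ [z _ <-].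
  apply: le_trans (phi_ge z) (le_trans _ (model_ge x z)).
  by rewrite leeDl// lee_fin mulr_ge0 ?sqr_ge0// ltW.
have env_xs : (fb_envelope f g gamma xs <= m%:E)%E by rewrite -xsm fb_envelope_le.
split.
  (* Both infima equal [m], and both are attained at [xs]. *)
  transitivity m%:E; [|symmetry]; apply/eqP; rewrite eq_le; apply/andP; split.
  - by apply: ereal_inf_lbound; exists xs.
  - by apply: le_ereal_inf_tmp => _ [z _ <-].
  - by apply: le_trans env_xs; apply: ereal_inf_lbound; exists xs.
  - by apply: le_ereal_inf_tmp => _ [z _ <-].
apply/seteqP; split => x xmin y.
  (* The envelope at [x] is at most the objective there, hence at most [m], which bounds the
     envelope below everywhere. *)
  apply: le_trans (env_ge y); rewrite -xsm.
  exact: le_trans (fb_envelope_le _ _ _ _) (xmin xs).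
(* Conversely, comparison with [xs] puts the envelope at [x] below [m], and the strict quadratic gap
   carries this over to the objective. *)
apply: le_trans (phi_ge y).
apply: (objective_le_of_fb_envelope f g f_diff c gamma m x g_lsc c0 (model_ge x)) => //.
exact: le_trans (xmin xs) env_xs.
Qed.
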